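(* Let $P$ be a poset with no infinite antichain and $\alpha$ a countable ordinal. The following are equivalent: (i) $P$ is $\alpha$-bqo; (ii) $(P;\leq_{succ})$ is $\alpha$-bqo; (iii) $(P;\leq_{pred})$ is $\alpha$-bqo; (iv) $(P;\leq_{crit})$ is $\alpha$-bqo; (v) $AM(P)$ is $\alpha$-bqo.
   Context: For $a,b\in P$: $a\leq_{pred} b$ iff every $x\in P$ with $x<a$ satisfies $x<b$; $a\leq_{succ} b$ iff every $y\in P$ with $b<y$ satisfies $a<y$; $a\leq_{crit} b$ iff both $a\leq_{pred} b$ and $a\leq_{succ} b$. These are quasi-orders on $P$. $AM(P)$ is the set of maximal antichains of $P$, ordered by domination: $X\leq Y$ iff for every $x\in X$ there is $y\in Y$ with $x\leq y$. Barriers and $\alpha$-bqo: finite subsets of $\mathbb{N}$ are identified with their increasing enumerations. For finite $s,t\subseteq\mathbb{N}$ write $s\triangleleft t$ if there is a finite $r\subseteq\mathbb{N}$ such that $s$ is a proper initial segment of $r$ and $t$ is $r$ with its least element removed. A barrier is an infinite set $B$ of finite subsets of $\mathbb{N}$, no member of which is a proper subset of another, such that every infinite $X\subseteq\bigcup B$ has a nonempty initial segment belonging to $B$. A barrier is well-ordered by the lexicographic order; its order type is the type of this well-order. A map $f$ from a barrier $B$ into a quasi-ordered set $Q$ is good if there exist $s,t\in B$ with $s\triangleleft t$ and $f(s)\leq f(t)$, and bad otherwise. $Q$ is $\alpha$-bqo if every map from a barrier of order type at most $\alpha$ into $Q$ is good. *)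

(* Defs.v *)
From mathcomp Require Import all_boot.
Set Implicit Arguments. Unset Strict Implicit. Unset Printing Implicit Defensive.

(** * Finite subsets of nat, identified with their increasing enumerations *)
Definition fsub (s : seq nat) : bool := sorted ltn s.

Fixpoint lexlt (s t : seq nat) : bool :=
  match s, t with
  | [::], _ :: _ => true
  | _, [::] => false
  | x :: s', y :: t' => (x < y) || ((x == y) && lexlt s' t')
  end.

Definition tri (s t : seq nat) : Prop :=
  exists r : seq nat, [/\ fsub r, prefix s r, size s < size r & t = behead r].

Definition fsubset (s t : seq nat) : Prop := forall n, n \in s -> n \in t.

Definition barrier (B : seq nat -> Prop) : Prop :=
  [/\ (forall s, B s -> fsub s),
      ~ (exists l : seq (seq nat), forall s, B s -> s \in l),
      (forall s t, B s -> B t -> fsubset s t -> s <> t -> False) &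
      (* every infinite X subset of the union of B, given by its strictly
         increasing enumeration x, has a nonempty initial segment in B *)
      (forall x : nat -> nat, (forall i, x i < x i.+1) ->
         (forall i, exists s, B s /\ x i \in s) ->
         exists n, 0 < n /\ B [seq x i | i <- iota 0 n])].

(** Countable ordinals are represented by a strict well-order [R] on a
    countable type [A]. *)
Definition countable_wellorder (A : Type) (R : A -> A -> Prop) : Prop :=
  [/\ (forall a, ~ R a a),
      (forall a b c, R a b -> R b c -> R a c),
      (forall a b, R a b \/ a = b \/ R b a),
      well_founded R &
      exists c : A -> nat, forall a b, c a = c b -> a = b].

(** The order type of (B, lexlt) is at most the order type of (A, R):
    there is a strictly increasing map from (B, lexlt) into (A, R). *)
Definition type_le (B : seq nat -> Prop) (A : Type) (R : A -> A -> Prop) : Prop :=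
  exists e : seq nat -> A, forall s t, B s -> B t -> lexlt s t -> R (e s) (e t).

Definition good (B : seq nat -> Prop) (Q : Type) (le : Q -> Q -> Prop)
  (f : seq nat -> Q) : Prop :=
  exists s t, [/\ B s, B t, tri s t & le (f s) (f t)].

Definition alpha_bqo (A : Type) (R : A -> A -> Prop) (Q : Type) (le : Q -> Q -> Prop) : Prop :=
  forall B : seq nat -> Prop, barrier B -> type_le B R ->
  forall f : seq nat -> Q, good B le f.

Definition partial_order (T : Type) (le : T -> T -> Prop) : Prop :=
  [/\ (forall x, le x x),
      (forall x y, le x y -> le y x -> x = y) &
      (forall x y z, le x y -> le y z -> le x z)].

Definition slt (T : Type) (le : T -> T -> Prop) (x y : T) : Prop := le x y /\ x <> y.

Definition no_infinite_antichain (T : Type) (le : T -> T -> Prop) : Prop :=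
  ~ exists a : nat -> T, forall i j, i <> j -> ~ le (a i) (a j).

Definition le_pred (T : Type) (le : T -> T -> Prop) (a b : T) : Prop :=
  forall x, slt le x a -> slt le x b.
Definition le_succ (T : Type) (le : T -> T -> Prop) (a b : T) : Prop :=
  forall y, slt le b y -> slt le a y.
Definition le_crit (T : Type) (le : T -> T -> Prop) (a b : T) : Prop :=
  le_pred le a b /\ le_succ le a b.

Definition antichain (T : Type) (le : T -> T -> Prop) (X : T -> Prop) : Prop :=
  forall x y, X x -> X y -> le x y -> x = y.
Definition max_antichain (T : Type) (le : T -> T -> Prop) (X : T -> Prop) : Prop :=
  antichain le X /\
  forall Y : T -> Prop, antichain le Y -> (forall x, X x -> Y x) -> forall y, Y y -> X y.

Definition AM (T : Type) (le : T -> T -> Prop) : Type := {X : T -> Prop | max_antichain le X}.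

Definition AM_le (T : Type) (le : T -> T -> Prop) (X Y : AM le) : Prop :=
  forall x, proj1_sig X x -> exists2 y, proj1_sig Y y & le x y.

(* Main.v *)
Require Import Defs.
From mathcomp Require Import all_boot.
From Stdlib Require Import Classical ClassicalEpsilon FunctionalExtensionality.

(* Infinite sets of naturals are increasing streams, [shift 1 z] being [z] without its least
   element, and a map [f] on a barrier [B] becomes the function [F z := f s], [s] the initial
   segment of [z] in [B]; [f] is bad exactly when [F z <= F (shift 1 z)] fails for all [z].
   Open sets of streams are Ramsey, so after thinning any relation of interest between [F z]
   and [F (shift 1 z)] may be assumed to hold always or never.

   Start from a bad [f] into [P].  If [F z <=_succ F (shift 1 z)] always, the absence of infinite
   antichains makes [F] take finitely many values on some stream, which is absurd; so [<=_succ]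
   inherits a bad map.  If [F z <=_pred F (shift 1 z)] always, [F] itself need not be bad for
   [<=_pred], but it can be replaced by a pointwise larger [g] with [F z] not below
   [g (shift 1 z)], and this [g] is bad for [<=_pred].  A map bad for [<=_pred] gives one bad for
   AM(P) by extending suitable finite antichains to maximal ones.  Conversely, from a bad map
   into AM(P), a fusion argument selects a bad map into [P]. *)

Set Implicit Arguments.
Unset Strict Implicit.
Unset Printing Implicit Defensive.

Lemma choice_fun (S Q : Type) (P : S -> Q -> Prop) :
  (forall s, exists q, P s q) -> exists g, forall s, P s (g s).
Proof.
move=> h; exists (fun s => proj1_sig (constructive_indefinite_description _ (h s))).
by move=> s; case: constructive_indefinite_description.
Qed.

(** * Increasing streams, tails and finite prefixes *)

Definition inc (x : nat -> nat) : Prop := forall i, x i < x i.+1.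

Definition infsub (y x : nat -> nat) : Prop :=
  inc y /\ forall i, exists j, y i = x j.

Definition shift (n : nat) (x : nat -> nat) (i : nat) : nat := x (n + i).

Definition app (u : seq nat) (x : nat -> nat) (i : nat) : nat :=
  if i < size u then nth 0 u i else x (i - size u).

(** Comparing with [x 0] alone suffices, since the streams in use are increasing. *)
Definition below (u : seq nat) (x : nat -> nat) : Prop :=
  forall a, a \in u -> a < x 0.

Definition ran (u : seq nat) (x : nat -> nat) : Prop :=
  forall a, a \in u -> exists j, a = x j.

Lemma inc_lt x i j : inc x -> i < j -> x i < x j.
Proof. by move=> h; apply: (homo_ltn ltn_trans h). Qed.

Lemma inc_le x i j : inc x -> i <= j -> x i <= x j.
Proof.
by move=> h; rewrite leq_eqVlt => /orP[/eqP->//|/(inc_lt h)/ltnW].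
Qed.

Lemma inc_ltE x i j : inc x -> x i < x j -> i < j.
Proof. by move=> h; rewrite ltnNge [in _ -> _]ltnNge; apply: contra; apply: inc_le. Qed.

Lemma inc_ge x i : inc x -> i <= x i.
Proof. by move=> h; elim: i => // i IH; apply: leq_ltn_trans IH (h i). Qed.

Lemma shift0 x : shift 0 x = x. Proof. by []. Qed.

Lemma shiftD m n x : shift m (shift n x) = shift (n + m) x.
Proof. by apply: functional_extensionality => i; rewrite /shift addnA. Qed.

Lemma inc_shift n x : inc x -> inc (shift n x).
Proof. by move=> h i; rewrite /shift addnS; apply: h. Qed.

Lemma infsub_refl x : inc x -> infsub x x.
Proof. by split=> // i; exists i. Qed.

Lemma infsub_trans y x z : infsub x y -> infsub y z -> infsub x z.
Proof.
move=> [hx sx] [_ sy]; split=> // i.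
by case: (sx i) => j ->; apply: sy.
Qed.

Lemma infsub_shift n y x : infsub y x -> infsub (shift n y) x.
Proof. by move=> [hy sy]; split=> [|i]; [apply: inc_shift | apply: sy]. Qed.

Lemma infsub_head y x : inc x -> infsub y x -> x 0 <= y 0.
Proof. by move=> hx [_ /(_ 0)[j ->]]; apply: inc_le. Qed.

Lemma infsub_tail n z y : inc y -> infsub z y -> y n < z 0 -> infsub z (shift n.+1 y).
Proof.
move=> hy [hz sz] hn; split=> // i; have [j e] := sz i.
have lt_nj : n < j.
  by apply: (inc_ltE hy); rewrite -e; apply: leq_trans hn _; apply: inc_le.
by exists (j - n.+1); rewrite /shift subnKC.
Qed.

Lemma below_infsub u x y : inc x -> below u x -> infsub y x -> below u y.
Proof. by move=> hx hu hy a /hu h; apply: leq_trans h (infsub_head hx hy). Qed.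

Lemma sorted_last u a : sorted ltn u -> a \in u -> a <= last 0 u.
Proof.
case/lastP: u => // u b; rewrite last_rcons mem_rcons inE => su /orP[/eqP->//|au].
apply: ltnW; move: su; rewrite (sorted_pairwise ltn_trans) pairwise_rcons => /andP[/allP h _].
exact: h.
Qed.

(** Entries of an increasing stream dominate their indices, so dropping [(last 0 u).+1] elements
    moves past [u] whatever the stream; for empty [u] the default [0] is harmless. *)
Lemma below_shift n u x : sorted ltn u -> inc x -> last 0 u < n -> below u (shift n x).
Proof.
move=> su hx hn a /(sorted_last su) h; rewrite /shift addn0.
exact: leq_trans (leq_ltn_trans h hn) (inc_ge _ hx).
Qed.

Lemma app_nil x : app [::] x = x.
Proof. by apply: functional_extensionality => i; rewrite /app subn0. Qed.

Lemma app_cons a u x : shift 1 (app (a :: u) x) = app u x.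
Proof. by apply: functional_extensionality => i; rewrite /app /shift add1n. Qed.

Lemma app_cat u v x : app (u ++ v) x = app u (app v x).
Proof.
apply: functional_extensionality => i; rewrite /app size_cat nth_cat subnDA.
case: (ltnP i (size u)) => h; first by rewrite ltn_addr.
by rewrite -{1}(subnKC h) ltn_add2l.
Qed.

Lemma app_rcons u x : app (rcons u (x 0)) (shift 1 x) = app u x.
Proof.
rewrite -cats1 app_cat; congr app; apply: functional_extensionality => -[|i] //.
by rewrite /app /shift /= add1n subn1.
Qed.

Lemma shift_app u x : shift (size u) (app u x) = x.
Proof.
by apply: functional_extensionality => i; rewrite /app /shift ltnNge leq_addr addKn.
Qed.

Lemma mkseq_app u x : mkseq (app u x) (size u) = u.
Proof.
apply: (@eq_from_nth _ 0) => [|i]; rewrite size_mkseq // => h.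
by rewrite nth_mkseq // /app h.
Qed.

Lemma app_mkseq n x : app (mkseq x n) (shift n x) = x.
Proof.
apply: functional_extensionality => i; rewrite /app size_mkseq.
by case: ltnP => h; [rewrite nth_mkseq | rewrite /shift subnKC].
Qed.

Lemma mem_mkseq (x : nat -> nat) n a : a \in mkseq x n -> exists2 i, i < n & a = x i.
Proof. by move/mapP=> [i]; rewrite mem_iota => hi ->; exists i. Qed.

Lemma mkseq_mem (x : nat -> nat) n i : i < n -> x i \in mkseq x n.
Proof. by move=> h; apply/mapP; exists i; rewrite // mem_iota. Qed.

Lemma sorted_mkseq x n : inc x -> sorted ltn (mkseq x n).
Proof.
move=> hx; rewrite /mkseq sorted_map; apply: sub_sorted (iota_ltn_sorted 0 n).
by move=> i j; apply: inc_lt.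
Qed.

Lemma take_mkseq (x : nat -> nat) m n : m <= n -> take m (mkseq x n) = mkseq x m.
Proof. by move=> h; rewrite /mkseq -map_take take_iota (minn_idPl h). Qed.

Lemma mkseq_shift1 x n : mkseq x n.+1 = x 0 :: mkseq (shift 1 x) n.
Proof. by rewrite /mkseq /= (iotaDl 1 0) -map_comp. Qed.

Lemma ran_mkseq x n y : infsub x y -> ran (mkseq x n) y.
Proof. by move=> [_ h] a /mem_mkseq[i _ ->]. Qed.

Lemma below_mkseq x n : inc x -> below (mkseq x n) (shift n x).
Proof. by move=> hx a /mem_mkseq[i hi ->]; rewrite /shift addn0; apply: inc_lt. Qed.

Lemma inc_app u x : sorted ltn u -> inc x -> below u x -> inc (app u x).
Proof.
move=> su hx hu i; rewrite /app.
case: (ltnP i.+1 (size u)) => h1.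
  by rewrite (ltnW h1); move/(sortedP 0): su => /(_ _ h1).
case: (ltnP i (size u)) => h2.
  have e : size u = i.+1 by apply/eqP; rewrite eqn_leq h1 h2.
  by rewrite e subnn; apply: hu; rewrite mem_nth.
by rewrite subSn.
Qed.

Lemma infsub_app u z x :
  sorted ltn u -> ran u x -> infsub z x -> below u z -> infsub (app u z) x.
Proof.
move=> su ru [hz sz] bu; split=> [|i]; first exact: inc_app.
by rewrite /app; case: ltnP => h; [apply/ru/mem_nth | apply: sz].
Qed.

Lemma eq_mkseq_app n z w : mkseq w n = mkseq z n -> w = app (mkseq z n) (shift n w).
Proof. by move=> <-; rewrite app_mkseq. Qed.

(** [y'] is the largest substream of [y] past [u], so a property obtained inside [y'] holds for
    every substream of [y] that lies past [u]. *)
Lemma tail_beyond u y : inc y -> sorted ltn u -> ran u y ->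
  exists y', [/\ infsub y' y, below u y' & forall z, infsub z y -> below u z -> infsub z y'].
Proof.
move=> iy su ru; case/lastP: u => [|u b] in su ru *.
  by exists y; split=> //; apply: infsub_refl.
have [|n eb] := ru b; first by rewrite mem_rcons mem_head.
exists (shift n.+1 y); split; first exact/infsub_shift/infsub_refl.
  move=> a /(sorted_last su); rewrite last_rcons eb => h.
  by apply: leq_ltn_trans h _; rewrite /shift addn0; apply: iy.
by move=> z hz bz; apply: infsub_tail => //; apply: bz; rewrite -eb mem_rcons mem_head.
Qed.

Lemma bounded_subsets k :
  exists l : seq (seq nat), forall u, sorted ltn u -> {in u, forall a, a < k} -> u \in l.
Proof.
elim: k => [|k [l hl]]; first by exists [:: [::]] => -[|a u] // _ /(_ a (mem_head _ _)).
exists (l ++ map (rcons^~ k) l) => u su hu; rewrite mem_cat.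
case/lastP: u su hu => [|u b] su hu; first by rewrite hl.
have bk : b <= k by apply: hu; rewrite mem_rcons mem_head.
move: (su); rewrite (sorted_pairwise ltn_trans) pairwise_rcons => /andP[/allP h].
rewrite -(sorted_pairwise ltn_trans) => su'.
case: (ltngtP b k) bk => // [bk|bk] _; apply/orP; [left|right].
  apply: hl => // a; rewrite mem_rcons inE => /orP[/eqP->//|/h ha]; exact: ltn_trans ha bk.
rewrite bk; apply: map_f; apply: hl => // a /h; by rewrite bk.
Qed.

(** * Fusion and the Ramsey property of open sets *)

Section Fusion.
Variables (d : nat -> nat) (Phi : seq nat -> (nat -> nat) -> Prop).
Hypothesis hd : inc d.
Hypothesis mono : forall u x y, infsub x d -> infsub y x -> Phi u x -> Phi u y.
Hypothesis dense : forall u x, sorted ltn u -> ran u d -> infsub x d -> below u x ->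
  exists2 y, infsub y x & Phi u y.

Let good_below k x := forall u, sorted ltn u -> ran u d -> {in u, forall a, a < k} -> Phi u x.

Let good_below_dense k x : infsub x d -> exists2 y, infsub y x & good_below k y.
Proof.
move=> hx; have [l hl] := bounded_subsets k.
suff [y hy h] : exists2 y, infsub y x &
    {in l, forall u, sorted ltn u -> ran u d -> Phi u y}.
  by exists y => // u su ru bu; apply: h => //; apply: hl.
elim: {hl} l => [|u l [y hy h]]; first by exists x => //; apply: infsub_refl; case: hx.
case: (classic (sorted ltn u /\ ran u d)) => [[su ru]|nu]; last first.
  exists y => // v; rewrite inE => /orP[/eqP-> su ru|]; last exact: h.
  by case: nu.
have hyd := infsub_trans hy hx.
have [|z hz hu] := dense su ru (infsub_shift (last 0 u).+1 hyd).
  by apply: below_shift => //; case: hy.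
have hzy : infsub z y by apply: infsub_trans hz _; apply/infsub_shift/infsub_refl; case: hy.
exists z; first exact: infsub_trans hy.
move=> v; rewrite inE => /orP[/eqP->//|vl sv rv].
exact: mono hyd hzy (h v vl sv rv).
Qed.

(** Diagonal construction: [X n.+1] is thinned inside [X n] so as to satisfy [Phi u] for the
    finitely many [u] with entries at most [X n 0]. The heads [y n := X n 0] form the stream: if the
    last entry of [u] is [y n], a substream of [y] past [u] lies inside [X n.+1]. *)
Lemma fusion : exists2 y, infsub y d &
  forall u z, sorted ltn u -> ran u y -> infsub z y -> below u z -> Phi u z.
Proof.
have [x0 hx0 g0] := good_below_dense 0 (infsub_refl hd).
have /choice_fun[next hnext] : forall x, exists y, infsub x d ->
    infsub y (shift 1 x) /\ good_below (x 0).+1 y.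
  move=> x; case: (classic (infsub x d)) => [hx|nx]; last by exists x.
  by have [y hy hg] := good_below_dense (x 0).+1 (infsub_shift 1 hx); exists y.
pose X n := iter n next x0.
have hX n : infsub (X n) d.
  by elim: n => //= n IH; have [h _] := hnext _ IH; apply: infsub_trans h (infsub_shift 1 IH).
have XS n : infsub (X n.+1) (shift 1 (X n)) by have [] := hnext _ (hX n).
have Xmono m n : infsub (X (m + n)) (X m).
  elim: n => [|n IH]; first by rewrite addn0; apply: infsub_refl; case: (hX m).
  rewrite addnS; apply: infsub_trans (XS _) _; exact: infsub_shift.
pose y n := X n 0.
have incy : inc y.
  move=> n; have := infsub_head (inc_shift 1 (proj1 (hX n))) (XS n).
  by apply: leq_trans; case: (hX n) => + _; apply.
have ysub m i : m <= i -> exists j, y i = X m j.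
  by move/subnKC <-; case: (Xmono m (i - m)) => _; apply.
exists y.
  by split=> // i; have [j] := ysub 0 i isT; case: (hX 0) => _ /(_ j)[k -> ->]; exists k.
move=> u z su ru [hz sz] bu.
have rud : ran u d.
  by move=> a /ru[j ->]; rewrite /y; case: (hX j) => _; apply.
case/lastP: u => [|u b] in su ru bu rud *.
  apply: mono hx0 _ (g0 [::] isT rud _) => //; split=> // i.
  by have [j ->] := sz i; apply: (ysub 0).
have [|n eb] := ru b; first by rewrite mem_rcons mem_head.
have hzX : infsub z (X n.+1).
  split=> // i; have [j ej] := sz i; rewrite ej; apply: ysub.
  apply: (inc_ltE incy); rewrite -ej -eb; apply: leq_trans (inc_le hz (leq0n i)).
  by apply: bu; rewrite mem_rcons mem_head.
apply: mono (hX _) hzX _; have [_] := hnext _ (hX n); apply=> // a.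
by move/(sorted_last su); rewrite last_rcons eb ltnS.
Qed.

End Fusion.

(** Openness in the space of infinite subsets of [d], with the topology of Baire space. *)
Definition open_on (d : nat -> nat) (U : (nat -> nat) -> Prop) : Prop :=
  forall z, infsub z d -> U z ->
  exists n, forall w, infsub w d -> mkseq w n = mkseq z n -> U w.

Lemma infinitely_often (Q : nat -> Prop) :
  (forall N, exists2 i, N <= i & Q i) -> exists2 k, inc k & forall i, Q (k i).
Proof.
move=> h; have /choice_fun[g hg] : forall N, exists i, N <= i /\ Q i.
  by move=> N; case: (h N) => i; exists i.
exists (fun n => iter n (fun i => g i.+1) (g 0)).
  by move=> i /=; case: (hg (iter i (fun i => g i.+1) (g 0)).+1).
by case=> [|i] /=; [case: (hg 0) | case: (hg (iter i (fun i => g i.+1) (g 0)).+1)].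
Qed.

Section OpenRamsey.
Variables (d : nat -> nat) (U : (nat -> nat) -> Prop).
Hypothesis hd : inc d.
Hypothesis oU : open_on d U.

(* Galvin's combinatorial forcing. *)
Let accept u x := forall z, infsub z x -> below u z -> U (app u z).
Let reject u x := forall y, infsub y x -> ~ accept u y.

Let accept_mono u x y : infsub y x -> accept u x -> accept u y.
Proof. by move=> hy h z hz; apply: h; apply: infsub_trans hy. Qed.

Let reject_mono u x y : infsub y x -> reject u x -> reject u y.
Proof. by move=> hy h z hz; apply: h; apply: infsub_trans hy. Qed.

Let step u x := accept u x \/ forall i, reject (rcons u (x i)) x.

(** A fusion first decides every one-element extension of [u]. If infinitely many [y i] give
    accepted extensions, the stream of these [y i] accepts [u]; otherwise some tail of [y] rejects
    all of its one-element extensions. *)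
Let step_dense u x : infsub x d -> exists2 y, infsub y x & step u y.
Proof.
move=> hx; have ix := proj1 hx.
have [||y hy hdec] := @fusion x (fun v w => accept (u ++ v) w \/ reject (u ++ v) w) ix.
- by move=> v w z _ hz [h|h]; [left; apply: accept_mono h | right; apply: reject_mono h].
- move=> v w _ _ hw _; case: (classic (exists2 z, infsub z w & accept (u ++ v) z)).
    by case=> z hz h; exists z => //; left.
  move=> h; exists w; first by apply: infsub_refl; case: hw.
  by right=> z hz a; apply: h; exists z.
have iy := proj1 hy.
have dec i z : infsub z y -> y i < z 0 -> accept (rcons u (y i)) z \/ reject (rcons u (y i)) z.
  move=> hz hi; rewrite -cats1; apply: hdec => // a; rewrite inE => /eqP-> //.
  by exists i.
pose acc i := accept (rcons u (y i)) (shift i.+1 y).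
have hS i : infsub (shift i.+1 y) y by apply/infsub_shift/infsub_refl.
have lS i : y i < shift i.+1 y 0 by rewrite /shift addn0; apply: iy.
case: (classic (forall N, exists2 i, N <= i & acc i)) => [/infinitely_often[k ik hk]|].
  have hyk : infsub (fun i => y (k i)) y.
    by split=> [i|i]; [apply: inc_lt | exists (k i)].
  exists (fun i => y (k i)); first exact: infsub_trans hy.
  left=> z hz bz; rewrite -app_rcons; have [j ej] := (proj2 hz 0).
  have iz := proj1 hz.
  rewrite ej; apply: (hk j).
    apply: infsub_tail => //; last by rewrite -ej; apply: iz.
    by apply: infsub_shift; apply: infsub_trans hyk.
  move=> a; rewrite mem_rcons inE => /orP[/eqP->|]; first by rewrite -ej; apply: iz.
  by move/bz => h; apply: ltn_trans (iz 0).
move=> /not_all_ex_not[N hN].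
exists (shift N y); first exact: infsub_shift.
right=> i z hz; set a := shift N y i => acz.
have [j hj ea] : exists2 j, N <= j & a = y j by exists (N + i); rewrite ?leq_addr.
apply: hN; exists j => //; rewrite ea in acz.
case: (dec j _ (hS j) (lS j)) => // rej; exfalso.
have zy : infsub z y by apply: infsub_trans hz _; apply/infsub_shift/infsub_refl.
have iz := proj1 zy.
(* Dropping [(y j).+1] elements moves [z] past [y j], where the rejection applies; acceptance passes
   to the thinner stream. *)
apply: (rej (shift (y j).+1 z)).
  apply: infsub_tail => //; first exact: infsub_shift.
  by rewrite /shift addn0; apply: inc_ge.
by apply: accept_mono acz; apply/infsub_shift/infsub_refl.
Qed.

(** After fusing [step], either the empty sequence is accepted and [U] holds throughout, or
    rejection propagates along the initial segments of every [z]. In the second case [U z] is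
    impossible: by openness a long enough initial segment of [z] would be accepted. *)
Lemma open_ramsey : exists2 y, infsub y d &
  (forall z, infsub z y -> U z) \/ (forall z, infsub z y -> ~ U z).
Proof.
have [||y hy hst] := @fusion d step hd.
- move=> u x y hx hy [h|h]; [left; exact: accept_mono h | right=> i].
  by have [j ->] := proj2 hy i; apply: reject_mono (h j).
- by move=> u x _ _ hx _; apply: step_dense.
exists y => //; have iy := proj1 hy.
have step_pre z n : infsub z y -> step (mkseq z n) (shift n z).
  move=> hz; apply: hst; [exact: sorted_mkseq (proj1 hz) | exact: ran_mkseq | exact: infsub_shift |].
  exact: below_mkseq (proj1 hz).
have ran0 : ran [::] y by [].
have below0 z : below [::] z by [].
have [h|h] := hst [::] y isT ran0 (infsub_refl iy) (below0 y).
  by left=> z hz; rewrite -(app_nil z); apply: h.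
right=> z hz Uz; have iz := proj1 hz.
have rej n : reject (mkseq z n.+1) (shift n.+1 z).
  elim: n => [|n IH].
    by have [j ej] := proj2 hz 0; rewrite /mkseq /= ej; apply: reject_mono (h j); apply: infsub_shift.
  have [a|/(_ 0)] := step_pre z n.+1 hz.
    by case: (IH (shift n.+1 z)) => //; apply/infsub_refl/inc_shift.
  rewrite {1}/shift addn0 -mkseqS; apply: reject_mono.
  have -> : shift n.+2 z = shift 1 (shift n.+1 z) by rewrite shiftD addn1.
  by apply/infsub_shift/infsub_refl/inc_shift.
have [n hn] := oU (infsub_trans hz hy) Uz.
apply: (rej n (shift n.+1 z)); first exact/infsub_refl/inc_shift.
move=> w hw bw; apply: hn.
  apply: infsub_app => //; first exact: sorted_mkseq.
    exact: ran_mkseq (infsub_trans hz hy).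
  by apply: infsub_trans hw _; apply: infsub_shift; apply: infsub_trans hy.
by rewrite -(take_mkseq (app _ _) (leqnSn n)) -{2}(size_mkseq z n.+1) mkseq_app take_mkseq.
Qed.

End OpenRamsey.

Lemma open_on_infsub d x U : infsub x d -> open_on d U -> open_on x U.
Proof.
move=> hx oU z hz Uz; have [n hn] := oU z (infsub_trans hz hx) Uz.
by exists n => w hw; apply: hn; apply: infsub_trans hx.
Qed.

Lemma finite_ramsey (Q : Type) (C : Q -> (nat -> nat) -> Prop) l d :
  inc d -> (forall q, open_on d (C q)) ->
  (forall z, infsub z d -> exists2 q, List.In q l & C q z) ->
  exists y q, [/\ infsub y d, List.In q l & forall z, infsub z y -> C q z].
Proof.
elim: l d => [|q l IH] d hd oC cov; first by have [] := cov d (infsub_refl hd).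
have [y hy [h|h]] := open_ramsey hd (oC q); first by exists y, q; split=> //; left.
have [|q' |z hz|x [q' [hx lq' hq']]] := IH y.
- by case: hy.
- exact: open_on_infsub (oC q').
- by have [q' [<-|? ?]] := cov z (infsub_trans hz hy); [move/(h z hz) | exists q'].
by exists x, q'; split=> //; [apply: infsub_trans hy | right].
Qed.

(** * Locally constant functions of streams *)

Definition locally_const (d : nat -> nat) (Q : Type) (h : (nat -> nat) -> Q) : Prop :=
  forall z, infsub z d ->
  exists n, forall w, infsub w d -> mkseq w n = mkseq z n -> h w = h z.

Lemma locally_const_open d (U : (nat -> nat) -> Prop) : locally_const d U -> open_on d U.
Proof. by move=> lU z hz Uz; have [n hn] := lU z hz; exists n => w hw /hn ->. Qed.

Lemma mkseq_leq (z w : nat -> nat) m n : m <= n -> mkseq w n = mkseq z n -> mkseq w m = mkseq z m.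
Proof. by move=> h e; rewrite -(take_mkseq w h) e take_mkseq. Qed.

(** Serves for relations between [F z] and a later value: the first value is frozen as [q], and what
    remains depends on the stream alone. *)
Lemma locally_const_bind d (Q Q' : Type) (h : (nat -> nat) -> Q) (k : Q -> (nat -> nat) -> Q') :
  locally_const d h -> (forall q, locally_const d (k q)) ->
  locally_const d (fun z => k (h z) z).
Proof.
move=> lh lk z hz; have [m hm] := lh z hz; have [n hn] := lk (h z) z hz.
exists (maxn m n) => w hw e; rewrite hm // ?hn //; apply: mkseq_leq e.
  exact: leq_maxr.
exact: leq_maxl.
Qed.

Lemma locally_const_comp d (Q Q' : Type) (h : (nat -> nat) -> Q) (k : Q -> Q') :
  locally_const d h -> locally_const d (fun z => k (h z)).
Proof. by move=> lh z hz; have [n hn] := lh z hz; exists n => w hw /hn ->. Qed.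

Lemma locally_const_shift d (Q : Type) (h : (nat -> nat) -> Q) n :
  locally_const d h -> locally_const d (fun z => h (shift n z)).
Proof.
move=> lh z hz; have [m hm] := lh _ (infsub_shift n hz).
exists (n + m) => w hw e; apply: hm (infsub_shift n hw) _.
apply: (@eq_from_nth _ 0) => [|i]; rewrite !size_mkseq // => hi.
have hi' : n + i < n + m by rewrite ltn_add2l.
by rewrite !nth_mkseq // /shift -(nth_mkseq 0 w hi') e nth_mkseq.
Qed.

Lemma locally_const_app d x (Q : Type) (h : (nat -> nat) -> Q) u :
  sorted ltn u -> ran u d -> infsub x d -> below u x ->
  locally_const d h -> locally_const x (fun z => h (app u z)).
Proof.
move=> su ru hx bu lh z hz; have ix := proj1 hx.
have happ w : infsub w x -> infsub (app u w) d.
  by move=> hw; apply: infsub_app => //; [apply: infsub_trans hx | apply: below_infsub hw].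
have [n hn] := lh _ (happ z hz).
exists n => w hw e; apply: hn (happ w hw) _.
apply: (@eq_from_nth _ 0) => [|i]; rewrite !size_mkseq // => hi.
rewrite !nth_mkseq // /app; case: ltnP => // _.
have hi' : i - size u < n by apply: leq_ltn_trans hi; apply: leq_subr.
by rewrite -(nth_mkseq 0 w hi') e nth_mkseq.
Qed.

(** * Antichains *)

Section Antichains.
Variables (T : Type) (le : T -> T -> Prop).
Hypothesis po : partial_order le.
Hypothesis nia : no_infinite_antichain le.

(** Iterating the extension would enumerate an infinite antichain. This one principle yields both
    the finiteness of antichains and, without Zorn's lemma, their extension to maximal ones. *)
Lemma antichain_no_growth (C : seq T -> Prop) l0 :
  (forall l, C l -> antichain le (fun p => List.In p l)) ->
  (forall l, C l -> exists p, ~ List.In p l /\ C (p :: l)) ->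
  ~ C l0.
Proof.
move=> anti ext C0.
have /choice_fun[g hg] : forall l, exists p, C l -> ~ List.In p l /\ C (p :: l).
  move=> l; case: (classic (C l)) => [/ext[p hp]|nC]; first by exists p.
  by have [p _] := ext _ C0; exists p.
pose L n := iter n (fun l => g l :: l) l0.
have CL n : C (L n) by elim: n => //= n /hg[].
have inL i j : i < j -> List.In (g (L i)) (L j).
  elim: j => // j IH; rewrite ltnS leq_eqVlt => /orP[/eqP->|/IH]; first by left.
  by right.
have neq i j : i < j -> g (L i) <> g (L j).
  by move=> h e; have [+ _] := hg _ (CL j); apply; rewrite -e; apply: inL.
apply: nia; exists (fun n => g (L n)) => i j ij leij.
have e : g (L i) = g (L j).
  by apply: (anti _ (CL (maxn i j).+1)) leij; apply: inL; rewrite ltnS ?leq_maxl ?leq_maxr.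
by case: (ltngtP i j) => // h; [apply: neq e | apply: (neq _ _ h)].
Qed.

Lemma antichain_finite S : antichain le S -> exists l, forall p, S p -> List.In p l.
Proof.
move=> aS; apply: NNPP => nfin.
apply: (@antichain_no_growth (fun l => forall p, List.In p l -> S p) [::]) => //.
  by move=> l hl p q /hl hp /hl hq; apply: aS.
move=> l hl; apply: NNPP => nex; apply: nfin; exists l => p Sp; apply: NNPP => np.
by apply: nex; exists p; split=> // q [<-|/hl].
Qed.

Lemma antichain_extends Y : antichain le Y -> exists X : AM le, forall p, Y p -> proj1_sig X p.
Proof.
move=> aY; apply: NNPP => nex.
apply: (@antichain_no_growth (fun l => antichain le (fun p => Y p \/ List.In p l)) [::]).
- by move=> l al p q hp hq; apply: al; right.
- move=> l al; apply: NNPP => nex'; apply: nex.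
  suff mx : max_antichain le (fun p => Y p \/ List.In p l) by exists (exist _ _ mx) => p; left.
  split=> // Z aZ sub p Zp; apply: NNPP => np; apply: nex'; exists p; split.
    by move=> lp; apply: np; right.
  have sub' q : Y q \/ List.In q (p :: l) -> Z q.
    by case=> [Yq|[<-//|lq]]; apply: sub; [left | right].
  by move=> q r /sub' hq /sub' hr; apply: aZ.
- by move=> p q [Yp|//] [Yq|//]; apply: aY.
Qed.

Lemma max_antichain_comparable (X : AM le) p :
  exists2 y, proj1_sig X y & le y p \/ le p y.
Proof.
case: po => refl _ _; case: X => X [aX mX] /=; apply: NNPP => nex.
have Xp : X p.
  apply: (mX (fun q => X q \/ q = p)); [|by left|by right].
  move=> q r [Xq|->] [Xr|->] // h; first exact: aX.
    by case: nex; exists q => //; left.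
  by case: nex; exists r => //; right.
by apply: nex; exists p => //; left.
Qed.

Lemma list_min l p : exists q, [/\ q = p \/ List.In q l, le q p &
  forall r, r = p \/ List.In r l -> le r q -> r = q].
Proof.
case: po => refl anti trans.
suff [q [hq qp minq]] : exists q, [/\ q = p \/ List.In q l, le q p &
    forall r, List.In r l -> le r q -> r = q].
  by exists q; split=> // r [->|/minq//] pq; apply: anti.
elim: l => [|r l [q [hq qp minq]]]; first by exists p; split; auto.
case: (classic (le r q)) => [rq|nrq]; last first.
  exists q; split=> //; first by case: hq; [left | right; right].
  by move=> s [<-|/minq//] /nrq.
exists r; split; [by right; left | exact: trans rq qp |].
move=> s [<-//|ls] sr; have e := minq s ls (trans _ _ _ sr rq).
by apply: anti => //; rewrite e.
Qed.

End Antichains.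

(** * Barriers *)

Definition base (B : seq nat -> Prop) (d : nat -> nat) : Prop :=
  inc d /\ forall i, exists s, B s /\ d i \in s.

(** Chosen by [epsilon] because a segment is only known to exist for streams inside a base. It is
    unique, two initial segments of one stream being comparable by inclusion. *)
Definition bseg (B : seq nat -> Prop) (z : nat -> nat) : seq nat :=
  epsilon (inhabits [::]) (fun s => B s /\ s = mkseq z (size s)).

Section Barrier.
Variable B : seq nat -> Prop.
Hypothesis bB : barrier B.

Lemma barrier_nil : ~ B [::].
Proof.
case: bB => _ inf anti _ B0; apply: inf; exists [:: [::]] => s Bs; rewrite inE.
by case: s Bs => // a s Bs; case: (anti _ _ B0 Bs).
Qed.

Lemma barrier_base : exists d, base B d.
Proof.
case: bB => sB inf _ _.
have [N|d incd hd] := @infinitely_often (fun i => exists s, B s /\ i \in s); last by exists d.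
apply: NNPP => nex; apply: inf; have [l hl] := bounded_subsets N.
exists l => s Bs; apply: hl; first exact: sB.
move=> a sa; rewrite ltnNge; apply/negP => Na; apply: nex; exists a => //.
by exists s.
Qed.

Lemma base_infsub d x : base B d -> infsub x d -> base B x.
Proof. by move=> [_ hd] [ix sx]; split=> // i; case: (sx i) => j ->; apply: hd. Qed.

Lemma bseg_uniq s z : inc z -> B s -> s = mkseq z (size s) -> bseg B z = s.
Proof.
case: bB => _ _ anti _ iz Bs es.
have [Bt et] : B (bseg B z) /\ bseg B z = mkseq z (size (bseg B z)).
  by apply: (epsilon_spec (inhabits [::]) (fun s => B s /\ s = mkseq z (size s))); exists s.
move: (bseg B z) Bt et => t Bt et; apply: NNPP => nts.
have sub p q : p = mkseq z (size p) -> q = mkseq z (size q) -> size p <= size q -> fsubset p q.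
  move=> -> -> h a; rewrite !size_mkseq in h * => /mem_mkseq[i hi ->].
  by apply: mkseq_mem; apply: leq_trans h.
case: (leqP (size s) (size t)) => h.
  by apply: (anti s t) => //; [exact: sub | auto].
by apply: (anti t s) => //; apply: sub => //; apply: ltnW.
Qed.

Variable d : nat -> nat.
Hypothesis hd : base B d.

Lemma bsegP z : infsub z d ->
  B (bseg B z) /\ bseg B z = mkseq z (size (bseg B z)).
Proof.
move=> hz; have [iz bz] := base_infsub hd hz; case: bB => _ _ _ /(_ z iz bz)[n [_ Bn]].
by rewrite (bseg_uniq iz Bn) size_mkseq.
Qed.

Lemma bseg_local z w n : infsub z d -> infsub w d ->
  size (bseg B z) <= n -> mkseq w n = mkseq z n -> bseg B w = bseg B z.
Proof.
move=> hz hw h e; have [Bz ez] := bsegP hz.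
by apply: bseg_uniq => //; [case: hw | rewrite (mkseq_leq h e)].
Qed.

Lemma bseg_locally_const : locally_const d (bseg B).
Proof. by move=> z hz; exists (size (bseg B z)) => w hw; apply: bseg_local. Qed.

(** The witness is [z 0 :: bseg B (shift 1 z)]. Were it no longer than [bseg B z], the segment of
    [shift 1 z] would be a proper subset of that of [z]. *)
Lemma bseg_tri z : infsub z d -> tri (bseg B z) (bseg B (shift 1 z)).
Proof.
move=> hz; have hz1 := infsub_shift 1 hz; have iz := proj1 hz.
have [Bs es] := bsegP hz; have [Bt et] := bsegP hz1.
set s := bseg B z in Bs es *; set t := bseg B _ in Bt et *.
have et' : z 0 :: t = mkseq z (size t).+1 by rewrite mkseq_shift1 -et.
have lt_st : size s < (size t).+1.
  rewrite ltnNge; apply/negP => h; case: bB => _ _ anti _; apply: (anti t s) => //.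
    rewrite et es => a /mem_mkseq[i hi ->].
    by apply: mkseq_mem; rewrite add1n; apply: leq_ltn_trans hi h.
  by move=> e; rewrite e ltnn in h.
exists (z 0 :: t); split=> //.
- by rewrite et'; apply: sorted_mkseq.
- by rewrite prefixE et' (take_mkseq _ (ltnW lt_st)) -es.
Qed.

(** Converse of [bseg_tri]: the witness [r] of [tri s t], followed by a tail of [H] past it, is the
    required stream. Its head lies in [H] because [s] is nonempty and starts with it. *)
Lemma tri_bseg s t H : inc H -> B s -> B t -> ran s H -> ran t H -> tri s t ->
  exists z, [/\ infsub z H, bseg B z = s & bseg B (shift 1 z) = t].
Proof.
move=> iH Bs Bt rs rt [[|a r] [sr psr ssr et]] //=; rewrite /= in et.
rewrite -{r}et in sr psr ssr.
case: s => [|b s] in Bs rs psr ssr *; first by case: barrier_nil.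
have eab : b = a by move: psr; rewrite prefix_cons => /andP[/eqP].
have rr : ran (a :: t) H.
  by move=> c; rewrite inE => /orP[/eqP->|/rt//]; rewrite -eab; apply: rs; rewrite mem_head.
set w := shift (last 0 (a :: t)).+1 H.
have bw : below (a :: t) w by apply: below_shift.
have hw : infsub w H by apply/infsub_shift/infsub_refl.
have hz : infsub (app (a :: t) w) H by apply: infsub_app.
exists (app (a :: t) w); split=> //.
  apply: bseg_uniq => //; first by case: hz.
  move: psr; rewrite prefixE => /eqP {1}<-; rewrite -[X in take _ X](mkseq_app _ w).
  by rewrite take_mkseq // ltnW.
rewrite app_cons; apply: bseg_uniq => //; last by rewrite mkseq_app.
by have /proj1 := infsub_shift 1 hz; rewrite app_cons.
Qed.

(** Infinitude holds because the segment of a far tail of [d] starts beyond all entries of any given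
    finite list. *)
Lemma barrier_restrict : barrier (fun s => B s /\ ran s d).
Proof.
case: bB => sB _ anti _; have incd := proj1 hd; split.
- by move=> s [/sB].
- move=> [l hl].
  have [N hN] : exists N, forall s a, s \in l -> a \in s -> a < N.
    elim: {hl} l => [|s l [N hN]]; first by exists 0.
    exists (maxn N (\max_(a <- s) a).+1) => t a; rewrite inE leq_max => /orP[/eqP->|tl] ta.
      by apply/orP; right; rewrite ltnS; apply: (@leq_bigmax_seq _ s xpredT (fun a => a)).
    by rewrite (hN t).
  have hz := infsub_shift N (infsub_refl incd).
  have [Bs es] := bsegP hz; set s := bseg B _ in Bs es.
  have ls : s \in l by apply: hl; split=> //; rewrite es; apply: ran_mkseq.
  have : shift N d 0 \in s.
    by rewrite es; apply: mkseq_mem; case: (s) Bs => // /barrier_nil.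
  by move/(hN s _ ls); rewrite /shift addn0 ltnNge inc_ge.
- by move=> s t [Bs _] [Bt _]; apply: anti.
- move=> x ix hx; have hxd : infsub x d.
    by split=> // i; case: (hx i) => s [[_ rs] /rs].
  have [Bs es] := bsegP hxd; exists (size (bseg B x)).
  have Ps : 0 < size (bseg B x) by case: (bseg B x) Bs => // /barrier_nil.
  by split=> //; rewrite -[[seq _ | _ <- _]]/(mkseq x _) -es; split=> //; rewrite es; apply: ran_mkseq.
Qed.

End Barrier.

(** Restricting [B] to [d] keeps it a barrier of no larger type, so good pairs exist inside every
    base stream. Bad maps can thus be thinned while [B] stays fixed. *)
Lemma alpha_bqoP (A : Type) (R : A -> A -> Prop) (Q : Type) (le : Q -> Q -> Prop) :
  alpha_bqo R le <->
  forall B, barrier B -> type_le B R -> forall d, base B d -> forall f,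
    exists2 z, infsub z d & le (f (bseg B z)) (f (bseg B (shift 1 z))).
Proof.
split=> [bqo B bB tB d hd f | h B bB tB f].
- have [|s [t [[Bs rs] [Bt rt] st lest]]] := bqo _ (barrier_restrict bB hd) _ f.
    by case: tB => e he; exists e => s t [Bs _] [Bt _]; apply: he.
  have [z [hz es et]] := tri_bseg bB (proj1 hd) Bs Bt rs rt st.
  by exists z; rewrite // es et.
- have [d hd] := barrier_base bB; have [z hz lez] := h B bB tB d hd f.
  have [Bs _] := bsegP bB hd hz; have [Bt _] := bsegP bB hd (infsub_shift 1 hz).
  by exists (bseg B z), (bseg B (shift 1 z)); split=> //; apply: bseg_tri hz.
Qed.

Lemma alpha_bqo_sub (A : Type) (R : A -> A -> Prop) (Q : Type) (le1 le2 : Q -> Q -> Prop) :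
  (forall a b, le1 a b -> le2 a b) -> alpha_bqo R le1 -> alpha_bqo R le2.
Proof.
move=> sub bqo B bB tB f; have [s [t [Bs Bt st h]]] := bqo B bB tB f.
by exists s, t; split=> //; apply: sub.
Qed.

(** * Successors *)

Section BadMaps.
Variables (T : Type) (le : T -> T -> Prop).
Hypothesis po : partial_order le.
Hypothesis nia : no_infinite_antichain le.

Lemma slt_le_trans a b c : slt le a b -> le b c -> slt le a c.
Proof.
case: po => _ anti trans [ab nab] bc; split; first exact: trans bc.
by move=> e; apply: nab; apply: anti => //; rewrite e.
Qed.

Lemma le_slt_trans a b c : le a b -> slt le b c -> slt le a c.
Proof.
case: po => _ anti trans ab [bc nbc]; split; first exact: trans bc.
by move=> e; apply: nbc; apply: anti => //; rewrite -e.
Qed.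

Lemma le_le_pred a b : le a b -> le_pred le a b.
Proof. by move=> ab x xa; apply: slt_le_trans xa ab. Qed.

Lemma le_le_succ a b : le a b -> le_succ le a b.
Proof. by move=> ab y; apply: le_slt_trans. Qed.

Variables (B : seq nat -> Prop) (d : nat -> nat) (f : seq nat -> T).
Hypothesis bB : barrier B.
Hypothesis hd : base B d.

Let F z := f (bseg B z).

(** The hypothesis, which goodness for [le'] supplies on every thinner stream, excludes the negative
    alternative of [open_ramsey]. *)
Lemma bad_homogeneous (le' : T -> T -> Prop) :
  (forall y, infsub y d -> exists2 z, infsub z y & le' (F z) (F (shift 1 z))) ->
  exists2 y, infsub y d & forall z, infsub z y -> le' (F z) (F (shift 1 z)).
Proof.
move=> h; have [|y hy [hU|hU]] := @open_ramsey d (fun z => le' (F z) (F (shift 1 z))) (proj1 hd).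
- apply: locally_const_open; apply: (locally_const_bind (k := fun p z => le' p (F (shift 1 z)))).
    by apply: locally_const_comp; apply: bseg_locally_const.
  move=> p; apply: (locally_const_shift (h := fun z => le' p (F z))).
  by apply: (locally_const_comp (fun s => le' p (f s))); apply: bseg_locally_const.
- by exists y.
by have [z hz lez] := h y hy; case: (hU z hz).
Qed.

(** With finitely many values, [F] is constant on a thinner stream, and reflexivity contradicts
    badness. *)
Lemma bad_not_finite y l : infsub y d ->
  (forall z, infsub z d -> ~ le (F z) (F (shift 1 z))) ->
  (forall z, infsub z y -> List.In (F z) l) -> False.
Proof.
case: po => refl _ _ hy bad fin.
have [||x [q [hx _ hq]]] := @finite_ramsey _ (fun q z => F z = q) l y (proj1 hy).
- move=> q; apply: open_on_infsub hy _; apply: locally_const_open.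
  by apply: (locally_const_comp (fun s => f s = q)); apply: bseg_locally_const.
- by move=> z /fin h; exists (F z).
have hxx := infsub_refl (proj1 hx).
apply: (bad x (infsub_trans hx hy)).
by rewrite (hq x hxx) (hq _ (infsub_shift 1 hxx)).
Qed.

(* For fixed [p], the values [F (shift 1 z)] with [F z = p] form an antichain: [p <=_succ _]
   would put [p] below any strictly larger one.  Hence only finitely many values are reached
   from an initial segment of [y] in a given number of steps, and [size s] steps from [s] reach
   every stream beyond [s]. *)
Lemma succ_not_bad y : infsub y d ->
  (forall z, infsub z d -> ~ le (F z) (F (shift 1 z))) ->
  ~ (forall z, infsub z y -> le_succ le (F z) (F (shift 1 z))).
Proof.
move=> hy bad hsucc; have iy := proj1 hy.
have next p : exists l, forall z, infsub z y -> F z = p -> List.In (F (shift 1 z)) l.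
  have [|l hl] := @antichain_finite T le nia
    (fun q => exists2 z, infsub z y & F z = p /\ F (shift 1 z) = q).
    move=> q1 q2 [z1 hz1 [e1 <-]] [z2 hz2 [e2 <-]] h; apply: NNPP => ne.
    apply: (bad z2 (infsub_trans hz2 hy)); rewrite e2 -e1.
    exact: (proj1 (hsucc z1 hz1 _ (conj h ne))).
  by exists l => z hz e; apply: hl; exists z.
set s := bseg B y.
have [Bs es] := bsegP bB hd hy; rewrite -/s in Bs es.
have reach k : exists l, forall z, infsub z y -> bseg B z = s -> List.In (F (shift k z)) l.
  elim: k => [|k [l hl]].
    by exists [:: f s] => z _ e; left; rewrite /F shift0 e.
  have [l' hl'] : exists l', forall z, infsub z y -> List.In (F z) l -> List.In (F (shift 1 z)) l'.
    elim: {hl} l => [|p l [l' hl']]; first by exists [::].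
    have [lp hlp] := next p; exists (lp ++ l') => z hz.
    by case=> [e|lz]; apply: List.in_or_app; [left; apply: hlp | right; apply: hl'].
  by exists l' => z hz e; rewrite -addn1 -shiftD; apply: hl'; [apply: infsub_shift | apply: hl].
have [l hl] := reach (size s).
apply: (bad_not_finite (infsub_shift (size s) hy) bad) => z hz.
have hzy := infsub_trans hz (infsub_shift (size s) (infsub_refl iy)).
have sy : ran s y by rewrite es; apply: ran_mkseq (infsub_refl iy).
have ss : sorted ltn s by rewrite es; apply: sorted_mkseq.
have bs : below s z.
  by apply: below_infsub hz; [apply: inc_shift | rewrite {1}es; apply: below_mkseq].
have hsz : infsub (app s z) y by apply: infsub_app.
rewrite -(shift_app s z); apply: hl => //.
by apply: bseg_uniq => //; [case: hsz | rewrite mkseq_app].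
Qed.

End BadMaps.

Section Equivalence.
Variables (T : Type) (le : T -> T -> Prop) (A : Type) (R : A -> A -> Prop).
Hypothesis po : partial_order le.
Hypothesis nia : no_infinite_antichain le.

Lemma succ_bqo : alpha_bqo R (le_succ le) -> alpha_bqo R le.
Proof.
move/alpha_bqoP=> bqo; apply/alpha_bqoP => B bB tB d hd f; apply: NNPP => nex.
have bad z : infsub z d -> ~ le (f (bseg B z)) (f (bseg B (shift 1 z))).
  by move=> hz h; apply: nex; exists z.
have [y hy|y hy hsucc] := @bad_homogeneous T B d f bB hd (le_succ le).
  by apply: bqo B bB tB _ (base_infsub hd hy) f.
by apply: (@succ_not_bad T le po nia B d f bB hd y).
Qed.

(** * Maximal antichains *)

Lemma In_mem (S : eqType) (a : S) l : a \in l -> List.In a l.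
Proof. by elim: l => //= b l IH; rewrite inE => /orP[/eqP->|/IH]; [left | right]. Qed.

(** Leaves only finitely many [s] for each [t]. If [t] is empty, [r] has one entry and [s] is empty,
    so the default of [last] does no harm. *)
Lemma tri_bounded s t : tri s t -> sorted ltn s /\ {in s, forall a, a < (last 0 t).+1}.
Proof.
move=> [r [sr psr ssr ->]]; case/prefixP: psr => v er.
have ss : sorted ltn s by move: sr; rewrite /fsub er => /cat_sorted2[].
split=> // a sa; have ra : a \in r by rewrite er mem_cat sa.
case: r => [|b [|c r]] in sr ssr ra {er} *; first by [].
  by case: s ssr sa {ss}.
by rewrite ltnS; apply: (sorted_last sr ra).
Qed.

(* Given a map [h] bad for [<=_pred], send [t] to a maximal antichain through [h t] having,
   for each of the finitely many [s] with [tri s t], an element strictly below [h s]. *)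
Lemma AM_pred_bqo : alpha_bqo R (@AM_le T le) -> alpha_bqo R (le_pred le).
Proof.
case: (po) => refl anti trans.
move/alpha_bqoP=> bqo; apply/alpha_bqoP => B bB tB d hd h; apply: NNPP => nex.
have /choice_fun[X hX] : forall t, exists X : AM le, proj1_sig X (h t) /\
    forall s, tri s t -> ~ le_pred le (h s) (h t) -> exists2 q, proj1_sig X q & slt le q (h s).
  move=> t.
  (* Each [x s] is equal or incomparable to [h t], so [h t] survives among the minimal elements [Y]
     of the list. A minimal element below [x s] will be the required one strictly below [h s]. *)
  have /choice_fun[x hx] : forall s, exists q, (le q (h t) \/ le (h t) q -> q = h t) /\
      (~ le_pred le (h s) (h t) -> slt le q (h s)).
    move=> s; case: (classic (le_pred le (h s) (h t))) => [hst|nst]; first by exists (h t).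
    case: (classic (slt le (h t) (h s))) => hts; first by exists (h t).
    have [q hq] := not_all_ex_not _ _ nst; have [qs nqt] := imply_to_and _ _ hq.
    exists q; split=> // -[qt|tq].
      by apply: NNPP => ne; apply: nqt.
    by case: hts; apply: (le_slt_trans po tq qs).
  have [L hL] := bounded_subsets (last 0 t).+1.
  pose l := map x L.
  pose Y q := (q = h t \/ List.In q l) /\ forall r, r = h t \/ List.In r l -> le r q -> r = q.
  have [|X hX] := @antichain_extends T le nia Y; first by move=> p q [pl _] [_ mq] /(mq _ pl).
  exists X; split.
    apply: hX; split; first by left.
    move=> r [//|/List.in_map_iff[s [<- _]]] rt.
    by apply: (proj1 (hx s)); left.
  move=> s st nst.
  have lx : List.In (x s) l.
    by apply: List.in_map; have [ss bs] := tri_bounded st; apply/In_mem/hL.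
  have [q [ql qx mq]] := list_min po (h t :: l) (x s).
  exists q; last first.
    have [xs nxs] := proj2 (hx s) nst.
    split; first exact: trans xs.
    by move=> e; apply: nxs; apply: anti => //; rewrite -e.
  apply: hX; split.
    by case: ql => [->|[<-|]]; [right | left | right].
  by move=> r [->|lr]; apply: mq; right; [left | right].
have [z hz hle] := bqo B bB tB d hd X.
set s := bseg B z in hle; set t := bseg B (shift 1 z) in hle.
have nst : ~ le_pred le (h s) (h t) by move=> e; apply: nex; exists z.
have [Xt wit] := hX t; have [Xs _] := hX s.
have [q Xq [qs nqs]] := wit s (bseg_tri bB hd hz) nst.
(* Now [q < h s <= y] with [q] and [y] both in the antichain [X t]. *)
have [y Xy sy] := hle _ Xs.
have e : q = y by apply: (proj1 (proj2_sig (X t))) => //; apply: trans sy.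
by apply: nqs; apply: anti => //; rewrite e.
Qed.

(* A witness [p] in [f s] of [f s] not below [f t] lies strictly above some element of [f t];
   thinning out by fusion, the same [p] serves for all [t] following [s]. *)
Lemma bqo_AM : alpha_bqo R le -> alpha_bqo R (@AM_le T le).
Proof.
case: (po) => refl anti trans.
move/alpha_bqoP=> bqo; apply/alpha_bqoP => B bB tB d hd f; apply: NNPP => nex.
pose mem (X : AM le) p := proj1_sig X p.
pose W p z := exists2 q, mem (f (bseg B (shift 1 z))) q & slt le q p.
have wit z : infsub z d -> exists2 p, mem (f (bseg B z)) p & W p z.
  move=> hz; apply: NNPP => nw; apply: nex; exists z => // p fp; apply: NNPP => np.
  apply: nw; exists p => //.
  have [y fy [yp|py]] := max_antichain_comparable po (f (bseg B (shift 1 z))) p.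
    by exists y => //; split=> // e; apply: np; exists p; rewrite -?e.
  by case: np; exists y.
have locW p : locally_const d (W p).
  apply: (locally_const_shift
    (h := fun z => exists2 q, mem (f (bseg B z)) q & slt le q p)).
  apply: (locally_const_comp (fun s => exists2 q, mem (f s) q & slt le q p)).
  exact: bseg_locally_const.
have [||y hy hsel] := @fusion d (fun u x => B u ->
    exists2 p, mem (f u) p & forall z, infsub z x -> W p (app u z)) (proj1 hd).
- move=> u x y _ hy h Bu; have [p fp hp] := h Bu; exists p => // z hz.
  by apply: hp; apply: infsub_trans hy.
- move=> u x su ru hx bu; have ix := proj1 hx.
  case: (classic (B u)) => [Bu|nBu]; last by exists x => //; apply: infsub_refl.
  (* As [f u] is finite, [finite_ramsey] finds a single witness valid for all continuations of [u]
     in a thinner stream. *)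
  have [l hl] := antichain_finite nia (proj1 (proj2_sig (f u))).
  have [p|z hz|x' [p [hx' _ hp]]] := @finite_ramsey _
      (fun p z => mem (f u) p /\ W p (app u z)) l x ix.
  + apply: locally_const_open; apply: (locally_const_comp (fun b => mem (f u) p /\ b)).
    exact: (locally_const_app su ru hx bu (locW p)).
  + have hz' : infsub (app u z) d.
      apply: infsub_app => //; first exact: infsub_trans hx.
      exact: below_infsub hz.
    have e : bseg B (app u z) = u.
      by apply: bseg_uniq => //; [case: hz' | rewrite mkseq_app].
    have [p fp Wp] := wit _ hz'; rewrite e in fp.
    by exists p; [apply: hl | split].
  exists x' => // _; exists p => [|z /hp[]//].
  by have [] := hp x' (infsub_refl (proj1 hx')).
have iy := proj1 hy.
have /choice_fun[g hg] : forall s, exists p, B s -> ran s y ->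
    mem (f s) p /\ forall z, infsub z y -> below s z -> W p (app s z).
  move=> s; case: (classic (B s /\ ran s y)) => [[Bs rs]|ns]; last first.
    have [p _ _] := wit d (infsub_refl (proj1 hd)).
    by exists p => Bs rs; case: ns.
  have ss : sorted ltn s by case: bB => sB _ _ _; apply: sB.
  have [y' [hy' by' maxy']] := tail_beyond iy ss rs.
  have [p fp hp] := hsel s y' ss rs hy' by' Bs.
  by exists p => _ _; split=> // z hz bz; apply: hp; apply: maxy'.
have [z hz hle] := bqo B bB tB y (base_infsub hd hy) g.
have iz := proj1 hz; have hz1 := infsub_shift 1 hz.
have [Bs es] := bsegP bB hd (infsub_trans hz hy).
have [Bt et] := bsegP bB hd (infsub_trans hz1 hy).
set s := bseg B z in hle Bs es *; set t := bseg B _ in hle Bt et *.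
have rs : ran s y by rewrite es; apply: ran_mkseq.
have rt : ran t y by rewrite et; apply: ran_mkseq.
have bs : below s (shift (size s) z) by rewrite {1}es; apply: below_mkseq.
have es' : app s (shift (size s) z) = z by rewrite {1}es app_mkseq.
have [_ Ws] := hg s Bs rs; have [ft _] := hg t Bt rt.
(* Here [q < g s <= g t], with [q] and [g t] both in the antichain [f t]. *)
have := Ws _ (infsub_shift _ hz) bs; rewrite es' => -[q fq [qs nqs]].
have e : q = g t by apply: (proj1 (proj2_sig (f t))) => //; apply: trans hle.
by apply: nqs; apply: anti => //; rewrite e.
Qed.

End Equivalence.

(** * Predecessors *)

Section UniformRelations.
Variables (T : Type) (le : T -> T -> Prop).
Hypothesis po : partial_order le.
Hypothesis nia : no_infinite_antichain le.
Variables (B : seq nat -> Prop) (f : seq nat -> T).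
Hypothesis bB : barrier B.

Let F z := f (bseg B z).

(** Since [w] starts past the segment that determines [F (app u z)], [rel] describes how [F] changes
    as the part after [u] is pushed far away. *)
Definition uniform (rel : T -> T -> Prop) (u : seq nat) (x : nat -> nat) : Prop :=
  forall z w, infsub z x -> infsub w x -> below u z -> below u w ->
  below (bseg B (app u z)) w -> rel (F (app u z)) (F (app u w)).

Definition sgt (a b : T) : Prop := slt le b a.

Definition ordered_at (u : seq nat) (x : nat -> nat) : Prop :=
  uniform eq u x \/ uniform (slt le) u x \/ uniform sgt u x.

Lemma uniform_infsub rel u x y : infsub y x -> uniform rel u x -> uniform rel u y.
Proof. by move=> hy h z w hz hw; apply: h; apply: infsub_trans hy. Qed.

(** Pushing the continuation of [u] again and again past the segments used before would give an
    infinite antichain. *)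
Lemma not_uniform_incomparable d u x :
  base B d -> sorted ltn u -> ran u d -> infsub x d -> below u x ->
  ~ uniform (fun a b => ~ le a b /\ ~ le b a) u x.
Proof.
move=> hd su ru hx bu unif; have ix := proj1 hx.
have hS n : infsub (shift n x) x by apply/infsub_shift/infsub_refl.
have bS n : below u (shift n x) by apply: below_infsub (hS n).
pose m k := iter k (fun n => n + (last 0 (bseg B (app u (shift n x)))).+1) 0.
have mS i j : i < j -> last 0 (bseg B (app u (shift (m i) x))) < m j.
  elim: j => // j IH; rewrite ltnS leq_eqVlt => /orP[/eqP<-|/IH h].
    exact: leq_addl.
  exact: leq_trans h (leq_addr _ _).
have inc_ij i j : i < j ->
    ~ le (F (app u (shift (m i) x))) (F (app u (shift (m j) x))) /\
    ~ le (F (app u (shift (m j) x))) (F (app u (shift (m i) x))).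
  move=> ij; apply: unif => //; apply: below_shift => //; last exact: mS.
  have hz : infsub (app u (shift (m i) x)) d.
    by apply: infsub_app => //; apply: infsub_shift.
  by have [_ ->] := bsegP bB hd hz; apply: sorted_mkseq (proj1 hz).
apply: nia; exists (fun k => F (app u (shift (m k) x))) => i j.
by case: (ltngtP i j) => // h _; have [] := inc_ij _ _ h.
Qed.

(** Colour [z] by the relation between [F (app u z)] and the value obtained after deleting from [z]
    the part that its segment uses. There are four colours, and incomparability is excluded on a
    homogeneous stream. *)
Lemma ordered_dense d u x :
  base B d -> sorted ltn u -> ran u d -> infsub x d -> below u x ->
  exists2 y, infsub y x & ordered_at u y.
Proof.
move=> hd su ru hx bu; have ix := proj1 hx.
pose incomp a b := ~ le a b /\ ~ le b a.
(* The number of elements of [z] in the segment of [app u z], truncated to 0 if the segment ends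
   within [u]. *)
pose n0 z := size (bseg B (app u z)) - size u.
pose C rel z : Prop := rel (F (app u z)) (F (app u (shift (n0 z) z))).
have happ z : infsub z x -> infsub (app u z) d.
  by move=> hz; apply: infsub_app => //; [apply: infsub_trans hx | apply: below_infsub hz].
have locF : locally_const x (fun z => bseg B (app u z)).
  exact: locally_const_app su ru hx bu (bseg_locally_const bB hd).
have [rel|z hz|y [rel [hy lrel hrel]]] :=
    @finite_ramsey _ C [:: eq; slt le; sgt; incomp] x ix.
- apply: locally_const_open.
  apply: (locally_const_bind
    (k := fun s z => rel (f s) (F (app u (shift (size s - size u) z)))) locF) => s.
  apply: (locally_const_shift (h := fun z => rel (f s) (F (app u z)))).
  exact: (locally_const_comp (fun t => rel (f s) (f t)) locF).
- rewrite /C; set a := F (app u z); set b := F (app u (shift _ z)).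
  case: (classic (a = b)) => [e|ne]; first by exists eq => //; left.
  case: (classic (le a b)) => [ab|nab]; first by exists (slt le) => //; right; left.
  case: (classic (le b a)) => [ba|nba].
    by exists sgt; [right; right; left | split; auto].
  by exists incomp; [right; right; right; left | split].
have unif : uniform rel u y.
  move=> z w hz hw bz bw bsw; set s := bseg B (app u z) in bsw.
  have hzx := infsub_trans hz hy; have iz := proj1 hz.
  have [Bs es] := bsegP bB hd (happ z hzx); rewrite -/s in Bs es.
  (* Splicing the used part [v] of [z] onto [w] turns the pair [z], [w] into the single stream
     [app v w], to which the colouring applies. *)
  set n := size s - size u; set v := mkseq z n.
  have bv : below v w.
    move=> a /mem_mkseq[i hi ->]; apply: bsw; rewrite es.
    have -> : z i = app u z (size u + i) by rewrite /app ltnNge leq_addr addKn.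
    by apply: mkseq_mem; rewrite -ltn_subRL.
  have hz' : infsub (app v w) y.
    by apply: infsub_app => //; [apply: sorted_mkseq | apply: ran_mkseq].
  have ez' : bseg B (app u (app v w)) = s.
    apply: (bseg_local bB hd (n := size (u ++ v))) => //.
    - exact: happ.
    - by apply: happ; apply: infsub_trans hy.
    - by rewrite size_cat size_mkseq -leq_subLR.
    - by rewrite -(app_mkseq n z) -/v -!app_cat !mkseq_app.
  have ew : shift n (app v w) = w by rewrite -(size_mkseq z n) shift_app.
  by have := hrel _ hz'; rewrite /C /n0 /F ez' -/n ew.
exists y => //; move: unif; case: lrel => [<-|[<-|[<-|[<-|[]]]]] unif.
- by left.
- by right; left.
- by right; right.
by case: (@not_uniform_incomparable d u y hd su ru (infsub_trans hy hx) _ unif); apply: below_infsub hy.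
Qed.

Lemma exists_ordered d : base B d -> exists2 y, infsub y d &
  forall u, sorted ltn u -> ran u y -> ordered_at u y.
Proof.
move=> hd; have [||y hy h] := @fusion d ordered_at (proj1 hd).
- move=> u x y _ hy [h|[h|h]]; [left|right; left|right; right]; exact: uniform_infsub h.
- by move=> u x; apply: ordered_dense.
exists y => // u su ru; have [y' [hy' by' maxy']] := tail_beyond (proj1 hy) su ru.
have ext rel : uniform rel u y' -> uniform rel u y.
  by move=> unif z w hz hw bz bw; apply: unif => //; apply: maxy'.
by have [/ext|[/ext|/ext]] := h u y' su ru hy' by'; [left | right; left | right; right].
Qed.

Variable d : nat -> nat.
Hypothesis hd : base B d.
Hypothesis bad : forall z, infsub z d -> ~ le (F z) (F (shift 1 z)).
Hypothesis hpred : forall z, infsub z d -> le_pred le (F z) (F (shift 1 z)).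
Hypothesis ordered : forall u, sorted ltn u -> ran u d -> ordered_at u d.

Let incd := proj1 hd.

Let sorted_bseg z : infsub z d -> sorted ltn (bseg B z).
Proof. by move=> hz; have [_ ->] := bsegP bB hd hz; apply: sorted_mkseq (proj1 hz). Qed.

(** Induction on [u]. For [a :: u], one would get [F (app (a :: u) w) < F (app (a :: u) z) <=_pred F
    (app u z) <= F (app u w)], the last by the induction hypothesis, against [bad]. For empty [u],
    iterating [hpred] would put [F w] strictly below itself. *)
Lemma pred_not_sgt u : sorted ltn u -> ran u d -> ~ uniform sgt u d.
Proof.
elim: u => [|a u IH] su ru unif.
  have chain k : le_pred le (F d) (F (shift k d)).
    elim: k => [|k IH] // p /IH hp; rewrite -addn1 -shiftD.
    by apply: (hpred (infsub_shift k (infsub_refl incd))).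
  have hdd := infsub_refl incd.
  set w := shift (last 0 (bseg B d)).+1 d; have hw : infsub w d by apply: infsub_shift.
  have b0 x : below [::] x by [].
  have bw : below (bseg B (app [::] d)) w.
    by rewrite app_nil; apply: below_shift => //; apply: sorted_bseg.
  have := unif d w hdd hw (b0 d) (b0 w) bw; rewrite !app_nil => lt_wd.
  by have [_] := chain (last 0 (bseg B d)).+1 _ lt_wd.
have su' : sorted ltn u by apply: path_sorted su.
have ru' : ran u d by move=> b hb; apply: ru; rewrite inE hb orbT.
have [z [hz bz _]] := tail_beyond incd su ru.
have iz := proj1 hz.
have bz' : below u z by move=> b hb; apply: bz; rewrite inE hb orbT.
have haz : infsub (app (a :: u) z) d by apply: infsub_app.
have huz : infsub (app u z) d by apply: infsub_app.
set s1 := bseg B (app (a :: u) z); set s2 := bseg B (app u z).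
set w := shift (maxn (last 0 s1) (last 0 s2)).+1 z.
have hwz : infsub w z by apply/infsub_shift/infsub_refl.
have hw := infsub_trans hwz hz.
have h1 : below s1 w by apply: below_shift; rewrite ?ltnS ?leq_maxl //; apply: sorted_bseg.
have h2 : below s2 w by apply: below_shift; rewrite ?ltnS ?leq_maxr //; apply: sorted_bseg.
have bw := below_infsub iz bz hwz; have bw' := below_infsub iz bz' hwz.
have lt1 : slt le (F (app (a :: u) w)) (F (app u z)).
  by rewrite -(app_cons a u z); apply: (hpred haz); apply: unif.
have le2 : le (F (app u z)) (F (app u w)).
  case: (ordered su' ru') => [h|[h|/(IH su' ru')//]].
    by rewrite (h z w) //; case: po.
  by have [] := h z w hz hw bz' bw' h2.
have haw : infsub (app (a :: u) w) d by apply: infsub_app.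
by apply: (bad haw); rewrite app_cons; have [] := slt_le_trans po lt1 le2.
Qed.

Let decided u := uniform eq u d.

(** Uniform equality only compares a stream with one far beyond it, so both values are compared with
    that of a common far tail of [d]. *)
Lemma decided_const u z w : sorted ltn u -> ran u d -> decided u ->
  infsub z d -> infsub w d -> below u z -> below u w -> F (app u z) = F (app u w).
Proof.
move=> su ru dec hz hw bz bw.
set n := maxn (last 0 u) (maxn (last 0 (bseg B (app u z))) (last 0 (bseg B (app u w)))).
have hx : infsub (shift n.+1 d) d by apply/infsub_shift/infsub_refl.
have bx s : sorted ltn s -> last 0 s <= n -> below s (shift n.+1 d) by move=> ss h; apply: below_shift.
have bux : below u (shift n.+1 d) by apply: bx => //; apply: leq_maxl.
rewrite (dec z (shift n.+1 d)) ?(dec w (shift n.+1 d)) //; apply: bx.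
- by apply/sorted_bseg/infsub_app.
- by rewrite !leq_max leqnn !orbT.
- by apply/sorted_bseg/infsub_app.
- by rewrite !leq_max leqnn !orbT.
Qed.

Lemma undecided_slt u : sorted ltn u -> ran u d -> ~ decided u -> uniform (slt le) u d.
Proof.
by move=> su ru nd; case: (ordered su ru) => [|[|/(pred_not_sgt su ru)]].
Qed.

Let decb u : bool := if excluded_middle_informative (decided u) then true else false.
Let decP u : reflect (decided u) (decb u).
Proof. by rewrite /decb; case: excluded_middle_informative => h; constructor. Qed.

Let mdec t := find (fun n => decb (take n t)) (iota 0 (size t).+1).

(** The search by [find] succeeds because the whole segment [bseg B z] determines [F] and is
    therefore decided. *)
Lemma mdecP z : infsub z d -> [/\ mdec (bseg B z) <= size (bseg B z),
  decided (mkseq z (mdec (bseg B z))) &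
  forall k, k < mdec (bseg B z) -> ~ decided (mkseq z k)].
Proof.
move=> hz; have [Bs es] := bsegP bB hd hz; set s := bseg B z in Bs es *.
pose p n := decb (take n s).
have hs : has p (iota 0 (size s).+1).
  apply/hasP; exists (size s); first by rewrite mem_iota /= add0n ltnSn.
  apply/decP; rewrite take_size => x w hx hw bx bw _.
  have Fapp v : infsub v d -> below s v -> F (app s v) = f s.
    move=> hv bv; rewrite /F; congr f; have ss : sorted ltn s by apply: sorted_bseg.
    by apply: bseg_uniq => //; [apply: inc_app; case: hv | rewrite mkseq_app].
  by rewrite !Fapp.
have lt_m : mdec s < (size s).+1 by move: (hs); rewrite has_find size_iota.
have tk k : k <= size s -> take k s = mkseq z k.
  by move=> h; rewrite {1}es take_mkseq.
split=> //.
  apply/decP; rewrite -tk //; have := nth_find 0 hs; rewrite nth_iota //.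
move=> k hk; have := before_find 0 hk; have hk' := ltn_trans hk lt_m.
by rewrite nth_iota // add0n tk // => /negbT/decP.
Qed.

(* Write [z'] for [shift 1 z].  Let [m z] be the length of the least decided initial segment
   of [z]; by thinning, [m z <= m z'].  Pushing all but the first [m z - 1] elements of [z] far
   away gives [F z < g (bseg z)].  But [F z < g (bseg z')] is impossible: [g (bseg z')] is
   [F x'] for some [x] sharing a decided initial segment with [z], so that [F z = F x]. *)
Lemma pred_bad_map : exists y g, infsub y d /\
  forall z, infsub z y -> ~ le_pred le (g (bseg B z)) (g (bseg B (shift 1 z))).
Proof.
case: (po) => refl _ _.
pose m z := mdec (bseg B z).
have locm : locally_const d m by apply: locally_const_comp; apply: bseg_locally_const.
have [|y hy mono] := @open_ramsey d (fun z => m z <= m (shift 1 z)) incd.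
  apply: locally_const_open.
  apply: (locally_const_bind (k := fun n z => is_true (n <= m (shift 1 z))) locm) => n.
  apply: (locally_const_shift (h := fun z => is_true (n <= m z))).
  exact: (locally_const_comp (fun k => is_true (n <= k)) locm).
have iy := proj1 hy.
(* In the negative alternative [m] would decrease strictly along all shifts of [y]. *)
have {}mono z : infsub z y -> m z <= m (shift 1 z).
  case: mono => [h|h]; first exact: h.
  have desc k : m (shift k y) + k <= m y.
    elim: k => [|k IH]; first by rewrite addn0.
    apply: leq_trans IH; rewrite addnS -addSn leq_add2r.
    have := h _ (infsub_shift k (infsub_refl iy)).
    by rewrite shiftD addn1 => /negP; rewrite -ltnNge.
  by have := desc (m y).+1; rewrite addnS ltnNge leq_addl.
(* If the empty sequence were decided, [F] would be constant, against [bad]; so [(m z).-1] is a true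
   predecessor. *)
have m_gt0 z : infsub z d -> 0 < m z.
  move=> hz; have [_ dec _] := mdecP hz; rewrite lt0n; apply/eqP => m0.
  rewrite -/(m z) m0 in dec; apply: (bad hz).
  have b0 x : below [::] x by [].
  have r0 : ran [::] d by [].
  have := @decided_const [::] z (shift 1 z) isT r0 dec hz (infsub_shift 1 hz) (b0 _) (b0 _).
  by rewrite !app_nil => ->.
pose tl t := shift (last 0 t).+1 y.
pose g t := F (app (take (mdec t).-1 t) (tl t)).
exists y, g; split=> // z hz lepred.
have hzd := infsub_trans hz hy; have iz := proj1 hz.
have hz1 := infsub_shift 1 hz; have hz1d := infsub_trans hz1 hy.
have gE x : infsub x y -> [/\ g (bseg B x) = F (app (mkseq x (m x).-1) (tl (bseg B x))),
    infsub (tl (bseg B x)) y, below (bseg B x) (tl (bseg B x)) &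
    below (mkseq x (m x).-1) (tl (bseg B x))].
  move=> hx; have hxd := infsub_trans hx hy; have [_ es] := bsegP bB hd hxd.
  have [le_m _ _] := mdecP hxd; have le_m1 := leq_trans (leq_pred _) le_m.
  have bt : below (bseg B x) (tl (bseg B x)) by apply: below_shift => //; apply: sorted_bseg.
  have et : take (m x).-1 (bseg B x) = mkseq x (m x).-1 by rewrite {1}es take_mkseq.
  split=> //; first by rewrite /g et.
    exact/infsub_shift/infsub_refl.
  by rewrite -et => a /mem_take; apply: bt.
have [gs hts bts bts'] := gE z hz; have [gt htt btt1 btt'] := gE _ hz1.
have ran_d x k : infsub x y -> ran (mkseq x k) d by move=> hx; apply: ran_mkseq (infsub_trans hx hy).
have up : slt le (F z) (g (bseg B z)).
  have [_ _ und] := mdecP hzd.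
  have nd : ~ decided (mkseq z (m z).-1) by apply: und; rewrite prednK // m_gt0.
  have := undecided_slt (sorted_mkseq _ iz) (ran_d z _ hz) nd.
  rewrite gs => /(_ (shift (m z).-1 z) (tl (bseg B z))); rewrite app_mkseq; apply=> //.
  - exact: infsub_shift.
  - exact: infsub_trans hts hy.
  - exact: below_mkseq.
have [le_F _] := lepred _ up.
rewrite gt in le_F; set n := (m (shift 1 z)).-1 in le_F btt'; set t := tl _ in le_F btt' htt btt1.
have en : n.+1 = m (shift 1 z) by rewrite prednK // m_gt0.
(* [x] is [z 0] followed by the stream that defines [g (bseg B (shift 1 z))]. As [m z <= n.+1], it
   shares with [z] the decided segment of length [m z], so [F x = F z]. *)
set x := app (mkseq z n.+1) t.
have bt : below (mkseq z n.+1) t.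
  rewrite mkseq_shift1 => a; rewrite inE => /orP[/eqP->|/btt'//].
  have [Bt et] := bsegP bB hd hz1d.
  apply: ltn_trans (iz 0) (btt1 (shift 1 z 0) _); rewrite et; apply: mkseq_mem.
  by case: (bseg _ _) Bt => // /(barrier_nil bB).
have hx : infsub x d.
  apply: infsub_app => //; [exact: sorted_mkseq | exact: ran_d | exact: infsub_trans htt hy].
have [le_mz dec _] := mdecP hzd; rewrite -/(m z) in le_mz dec.
have mzn : m z <= n.+1 by rewrite en; apply: mono.
have exz : mkseq x (m z) = mkseq z (m z).
  by apply: mkseq_leq mzn _; rewrite -{1}(size_mkseq z n.+1) mkseq_app.
have eF : F (app (mkseq z (m z)) (shift (m z) x)) = F (app (mkseq z (m z)) (shift (m z) z)).
  apply: decided_const => //; try exact: infsub_shift.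
  - exact: sorted_mkseq.
  - exact: ran_d.
  - by rewrite -exz; apply: below_mkseq (proj1 hx).
  - exact: below_mkseq.
have ex1 : shift 1 x = app (mkseq (shift 1 z) n) t by rewrite /x mkseq_shift1 app_cons.
rewrite -(eq_mkseq_app exz) app_mkseq in eF.
by apply: (bad hx); rewrite ex1 eF.
Qed.

End UniformRelations.

Lemma pred_bqo (T : Type) (le : T -> T -> Prop) (A : Type) (R : A -> A -> Prop) :
  partial_order le -> no_infinite_antichain le ->
  alpha_bqo R (le_pred le) -> alpha_bqo R le.
Proof.
move=> po nia /alpha_bqoP bqo; apply/alpha_bqoP => B bB tB d hd f; apply: NNPP => nex.
have bad z : infsub z d -> ~ le (f (bseg B z)) (f (bseg B (shift 1 z))).
  by move=> hz h; apply: nex; exists z.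
have [y hy|y hy hpred] := @bad_homogeneous T B d f bB hd (le_pred le).
  by apply: bqo B bB tB _ (base_infsub hd hy) f.
have [x hx ord] := exists_ordered nia f bB (base_infsub hd hy).
have hxd := infsub_trans hx hy.
have [|z hz|v [g [hv hg]]] := @pred_bad_map T le po B f bB x (base_infsub hd hxd) _ _ ord.
- by move=> z hz; apply: bad; apply: infsub_trans hxd.
- by apply: hpred; apply: infsub_trans hx.
have [z hz] := bqo B bB tB v (base_infsub hd (infsub_trans hv hxd)) g.
exact: hg.
Qed.

(** * Assembling the equivalences *)

Unset Implicit Arguments.

Theorem theorem5p5 (T : Type) (le : T -> T -> Prop) (A : Type) (R : A -> A -> Prop) :
  partial_order le -> no_infinite_antichain le -> countable_wellorder R ->
  [/\ alpha_bqo R le <-> alpha_bqo R (le_succ le),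
      alpha_bqo R le <-> alpha_bqo R (le_pred le),
      alpha_bqo R le <-> alpha_bqo R (le_crit le) &
      alpha_bqo R le <-> alpha_bqo R (@AM_le T le)].
Proof.
move=> po nia _; have pred := @pred_bqo T le A R po nia.
split; split.
- exact/alpha_bqo_sub/le_le_succ.
- exact: succ_bqo.
- exact/alpha_bqo_sub/le_le_pred.
- exact: pred.
- by apply: alpha_bqo_sub => a b h; split; [apply: le_le_pred | apply: le_le_succ].
- by move=> h; apply: pred; apply: alpha_bqo_sub h => a b [].
- exact: bqo_AM.
- by move=> h; apply/pred/AM_pred_bqo.
Qed.
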